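(* There exists a constant $K>0$ depending on $\mu$ and $\lambda$ such that for all $x\in\{0,1\}^N$, $N\ge\lceil r_{\min}^{-1}\rceil$ and $T\ge1$, $$\inf_{(\widehat{\mathcal P}_+,\widehat{\mathcal P}_-)}\ \max_{S\in\mathcal S}\ \mathbb P_{x,S}\big((\widehat{\mathcal P}_+,\widehat{\mathcal P}_-)\ne(S,S^c)\big)\ \ge\ \phi(N)\left(1-\frac{1}{\log(Nr_{\min}-1)}\Big(\frac{2KT}{N}+\sqrt{\frac{KT}{N}}\Big)\right),$$ where $r_{\min}=r_+\wedge r_-$, $\mathcal S=\{S\subset[N]:|S|=\lceil Nr_+\rceil\}$, $\phi(N)=\frac{\sqrt{Nr_{\min}-1}}{1+\sqrt{Nr_{\min}-1}}$, and the infimum is taken over all random partitions $(\widehat{\mathcal P}_+,\widehat{\mathcal P}_-)$ of $[N]$ which are measurable with respect to $\sigma(X_1,\dots,X_{T+1})$.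
   Context: Model. Fix $0<\lambda<1$, $0<\mu\le\lambda$, $0<p\le1$ and $r_+,r_-\in(0,1)$ with $r_++r_-=1$; $[N]=\{1,\dots,N\}$, $S^c=[N]\setminus S$. For $x\in\{0,1\}^N$ and $S\in\mathcal S$, $\mathbb P_{x,S}$ is the probability measure under which $\theta=(\theta_{ij})_{i,j\in[N]}$ is i.i.d. $\mathrm{Ber}(p)$ and, conditionally on $\theta$, $(X_t)_{t\ge1}$ is the Markov chain on $\{0,1\}^N$ started from $X_1=x$ (so not stationary) such that, given $X_{t-1}=y$, the coordinates of $X_t$ are independent with $X_{i,t}\sim\mathrm{Ber}(p_{\theta,S,i}(y))$, where $$p_{\theta,S,i}(y)=\mu+\frac{1-\lambda}{N}\Big(\sum_{j\in S}\theta_{ij}y_j+\sum_{j\in S^c}\theta_{ij}(1-y_j)\Big).$$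
   Formalization: The range 1 < N r_min ≤ 2 is excluded: for 1 < N r_min < 2 the logarithm is negative, so the right side exceeds 1 for large T (e.g. r_+ = r_- = 1/2, N = 3) and the bound is false; for N r_min = 2 it contains 1/log 1, which is undefined. *)

(* Defs.v *)
From mathcomp Require Import all_boot all_order all_algebra.
From mathcomp Require Import all_classical all_reals all_analysis.

Set Implicit Arguments.
Unset Strict Implicit.
Unset Printing Implicit Defensive.

Import Order.TTheory GRing.Theory Num.Theory.
Local Open Scope classical_set_scope.
Local Open Scope ring_scope.

Notation state N := {ffun 'I_N -> bool}.

(* Sample space carrying theta and (X_1, ..., X_{T+1}): only these variables
   enter the events considered.  Times are shifted by one, so that [w.2 t] is
   X_{t+1} for t = 0, ..., T. *)
Notation outcome N T := ('M[bool]_N * {ffun 'I_T.+1 -> state N})%type.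

Definition theta (N T : nat) (w : outcome N T) : 'M[bool]_N := w.1.

Definition traj (N T : nat) (w : outcome N T) : {ffun 'I_T.+1 -> state N} :=
  w.2.

Section Model.
Context {R : realType}.
Variables (lambda mu p : R) (N : nat).

Definition success_prob (th : 'M[bool]_N) (S : {set 'I_N}) (i : 'I_N)
    (y : state N) : R :=
  mu + (1 - lambda) / N%:R *
    (\sum_(j in S) (th i j)%:R * (y j)%:R +
     \sum_(j in ~: S) (th i j)%:R * (1 - (y j)%:R)).

(* [bernoulli_pmf q b] is q if b = true and 1 - q otherwise. *)
Definition transition (th : 'M[bool]_N) (S : {set 'I_N}) (y z : state N) : R :=
  \prod_(i < N) bernoulli_pmf (success_prob th S i y) (z i).

(* Joint mass function of (theta, X_1, ..., X_{T+1}) under P_{x,S}. *)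
Definition law (x : state N) (S : {set 'I_N}) (T : nat) (w : outcome N T) : R :=
  (\prod_(i < N) \prod_(j < N) bernoulli_pmf p (theta w i j)) *
  (traj w ord0 == x)%:R *
  \prod_(t < T) transition (theta w) S
    (traj w (widen_ord (leqnSn T) t)) (traj w (lift ord0 t)).

Definition Prob (x : state N) (S : {set 'I_N}) (T : nat)
    (E : pred (outcome N T)) : R :=
  \sum_(w | E w) law x S w.

End Model.

(* Ordered pairs of complementary sets; an empty block is allowed. *)
Definition is_bipartition (N : nat) (P : {set 'I_N} * {set 'I_N}) : bool :=
  (P.1 :|: P.2 == [set: 'I_N])%SET && [disjoint P.1 & P.2].

(* sigma(X_1, ..., X_{T+1}): inverse images under the trajectory map; every
   subset of the finite set of trajectories is measurable. *)
Definition sigma_traj (N T : nat) : set (set (outcome N T)) :=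
  preimage_set_system [set: outcome N T] (@traj N T) [set: set _].

Definition estimator (N T : nat) : set (outcome N T -> {set 'I_N} * {set 'I_N}) :=
  [set W | (forall w, is_bipartition (W w)) /\
           (forall A, sigma_traj (W @^-1` A))].

Section Risk.
Context {R : realType}.
Variables (lambda mu p rp : R) (N : nat) (x : state N) (T : nat).

Definition admissible (S : {set 'I_N}) : bool :=
  #|S|%:Z == Num.ceil (N%:R * rp).

(* Probabilities are nonnegative, so the default value 0 of the maximum is
   harmless as soon as some S is admissible. *)
Definition max_risk (W : outcome N T -> {set 'I_N} * {set 'I_N}) : R :=
  \big[Num.max/0]_(S : {set 'I_N} | admissible S)
    Prob lambda mu p x S (fun w => W w != (S, ~: S)%SET).

Definition minimax_risk : R := inf [set max_risk W | W in @estimator N T].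

End Risk.

Definition phi {R : realType} (N : nat) (rmin : R) : R :=
  Num.sqrt (N%:R * rmin - 1) / (1 + Num.sqrt (N%:R * rmin - 1)).

(* Main.v *)
Require Import Defs.
From mathcomp Require Import all_boot all_order all_algebra.
From mathcomp Require Import all_classical all_reals all_analysis.
From mathcomp Require Import ring lra zify.

(* The lower bound holds even for estimators that observe theta, so we condition
   on theta.  Fix c in {true, false} and a set S0 whose c-side
   J = {k | (k \in S0) = c} has M > N / 2 elements, and test between the sets
   S_j obtained by moving one j in J to the other side of S0; the reference law
   is the Markov chain whose success probabilities are averaged over j in J.
   With likelihood threshold u = (N rmin - 1)^(1/4), the total probability that
   the correct S_j is selected is at most u plus the probabilities that the
   likelihood ratio exceeds u, and the latter are controlled by the
   Kullback-Leibler divergences.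

   Success probabilities may be close to 1 when mu = lambda, so the divergence
   of one coordinate i is of order h_ij / (N H_i) + 1 / (N M), where h_ij = 1 if
   the edge from j to i is inactive and H_i is the sum of the h_ij over j in J.
   Now h_ij / H_i is at most the share of j among the k in J with theta_ik = 0
   plus its share among the k in J whose state differs from c.  Shares sum to 1
   over j, which handles the first share, and the second one at the initial
   time; at later times the expected second share of j is at most of order
   1 / M plus the share of j in the numbers of zeros of the rows of theta.
   Hence the divergences add up to O(T), that is O(T / N) on average. *)

Set Implicit Arguments.
Unset Strict Implicit.
Unset Printing Implicit Defensive.

Import Order.TTheory GRing.Theory Num.Theory.
Local Open Scope classical_set_scope.
Local Open Scope ring_scope.

(** * Divergence and multiple hypothesis testing *)

Section LogInequalities.
Context {R : realType}.
Implicit Types a b r u : R.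

Lemma ln_le_subr1 u : 0 < u -> ln u <= u - 1.
Proof.
move=> u0; have := @le_ln1Dx R (u - 1).
by rewrite subrKC; apply; rewrite ltrBrDr addNr.
Qed.

Lemma ln_ge_1subV u : 0 < u -> 1 - u^-1 <= ln u.
Proof.
move=> u0; have := @ln_le_subr1 u^-1.
by rewrite invr_gt0 lnV ?posrE // => /(_ u0); lra.
Qed.

(** [P * log_gap (P / Q)] is [P * ln (P / Q) - P + Q]: the divergence integrand made nonnegative,
    with the same total for probability laws. *)
Definition log_gap u : R := ln u - 1 + u^-1.

Lemma log_gap_ge0 u : 0 < u -> 0 <= log_gap u.
Proof. by move=> /ln_ge_1subV; rewrite /log_gap; lra. Qed.

(** [ln_ge_1subV] at [u / r] bounds the increment below by [(1 - r / u) * (1 - r^-1)]. *)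
Lemma le_log_gap r u : 1 <= r -> r <= u -> log_gap r <= log_gap u.
Proof.
move=> r1 ru; have r0 : 0 < r by lra.
have u0 : 0 < u by lra.
have := @ln_ge_1subV (u / r) (divr_gt0 u0 r0).
rewrite ln_div ?posrE // /log_gap invf_div => h.
have ur : r / u <= 1 by rewrite ler_pdivrMr ?mul1r.
have : 0 <= (1 - r / u) * (1 - r^-1).
  by rewrite mulr_ge0 // subr_ge0 // invf_le1.
have -> : (1 - r / u) * (1 - r^-1) = 1 - r / u - r^-1 + u^-1 by field; lra.
lra.
Qed.

(** With [l = ln u] the gap is [exp (- l) - 1 + l]. The inequality [1 - l / 2 <= exp (- l / 2)] may
    be squared because [l <= 2]. *)
Lemma log_gap_ge_sqr u : 1 <= u -> ln u <= 2 -> ln u ^+ 2 / 4 <= log_gap u.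
Proof.
move=> u1 l2; have u0 : 0 < u by lra.
have := @expR_ge1Dx R (- (ln u / 2)) => h.
have : (1 + - (ln u / 2)) ^+ 2 <= expR (- (ln u / 2)) ^+ 2.
  by rewrite ler_sqr ?nnegrE ?expR_ge0 //; lra.
rewrite [X in _ <= X]expr2 -expRD.
have -> : - (ln u / 2) + - (ln u / 2) = - ln u by field.
rewrite expRN lnK ?posrE // /log_gap; nra.
Qed.

Lemma log_gap_ge_half u : 1 <= u -> 2 <= ln u -> ln u / 2 <= log_gap u.
Proof.
move=> u1 l2; have : 0 < u^-1 by rewrite invr_gt0; lra.
by rewrite /log_gap; lra.
Qed.

(* The divisions by 0 are harmless: if [b = 1], the hypothesis forces
   [a = 1] and both sides are 0. *)
Lemma bernoulli_kl_le a b : 0 <= a <= 1 -> 0 < b <= 1 -> (b = 1 -> a = 1) ->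
  a * ln (a / b) + (1 - a) * ln ((1 - a) / (1 - b)) <=
  (a - b) ^+ 2 / (b * (1 - b)).
Proof.
move=> /andP[a0 a1] /andP[b0 b1] ab.
have [b1E|b1N] := eqVneq b 1.
  by rewrite b1E (ab b1E) !subrr divr1 ln1 !(mul0r, mulr0, addr0, expr0n) /=.
have {}b1 : 0 < 1 - b by rewrite subr_gt0 lt_neqAle b1N.
(* Bounding both logarithms by [ln x <= x - 1] leaves exactly the chi-square distance. *)
have key (c d : R) : 0 <= c -> 0 < d -> c * ln (c / d) <= c * (c / d - 1).
  rewrite le_eqVlt => /predU1P[<-|c0] d0; first by rewrite !mul0r.
  by rewrite ler_pM2l // ln_le_subr1 // divr_gt0.
apply: le_trans (lerD (key a b a0 b0) (key (1 - a) (1 - b) _ b1)) _; first lra.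
by rewrite le_eqVlt; apply/predU1P; left; field; rewrite !gt_eqF.
Qed.

End LogInequalities.

Section LikelihoodTest.
Context {R : realType} {Omega : finType}.

Definition kl (P Q : Omega -> R) : R := \sum_w P w * ln (P w / Q w).

(* Markov's inequality for [log_gap (P / Q)], whose P-expectation is at most
   the divergence because [Q / P] has P-expectation at most 1. *)
Lemma likelihood_ratio_tail (P Q : Omega -> R) (r : R) :
  (forall w, 0 <= P w) -> (forall w, 0 <= Q w) ->
  (forall w, Q w = 0 -> P w = 0) ->
  \sum_w P w = 1 -> \sum_w Q w = 1 -> 1 <= r ->
  (\sum_(w | r * Q w < P w) P w) * log_gap r <= kl P Q.
Proof.
move=> P0 Q0 PQ P1 Q1 r1.
have -> : kl P Q = \sum_w (P w * ln (P w / Q w) - P w + Q w).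
  by rewrite big_split /= sumrB P1 Q1 subrK.
rewrite big_distrl /= [leLHS]big_mkcond /=; apply: ler_sum => w _.
have [Pw0|Pw] := eqVneq (P w) 0.
  by rewrite Pw0 !mul0r subrr add0r; case: ifP.
have {}Pw : 0 < P w by rewrite lt_neqAle eq_sym Pw P0.
have Qw : 0 < Q w.
  rewrite lt_neqAle eq_sym Q0 andbT; apply/eqP => /PQ Pw0.
  by rewrite Pw0 ltxx in Pw.
have -> : P w * ln (P w / Q w) - P w + Q w = P w * log_gap (P w / Q w).
  by rewrite /log_gap; field; rewrite !gt_eqF.
case: ifPn => [rQ|_]; last by rewrite mulr_ge0 ?log_gap_ge0 ?divr_gt0 // ltW.
by rewrite ler_pM2l // le_log_gap // ler_pdivlMr // ltW.
Qed.

Lemma sum_disjoint_le1 (I : finType) (L : eqType) (J : {set I}) (lab : I -> L)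
    (W : Omega -> L) (Q : Omega -> R) :
  {in J &, injective lab} -> (forall w, 0 <= Q w) -> \sum_w Q w = 1 ->
  \sum_(j in J) \sum_(w | W w == lab j) Q w <= 1.
Proof.
move=> labI Q0 <-; rewrite (exchange_big_dep xpredT) //=.
apply: ler_sum => w _.
have [/existsP[j /andP[jJ /eqP Wj]]|/existsPn nj] :=
  boolP [exists j, (j \in J) && (W w == lab j)].
  rewrite (bigD1 j) /= ?jJ ?Wj ?eqxx // big1 ?addr0 // => k.
  case/andP=> /andP[kJ /eqP lk] /negP[]; apply/eqP; exact: labI.
by rewrite big1 // => j /andP[jJ Wj]; have := nj j; rewrite jJ Wj.
Qed.

(** Where [P j <= r * Q], correct answers are compared with [Q], under which these disjoint events
    weigh at most 1 in total; the rest is the exceedance term. *)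
Lemma multiple_test_error (I : finType) (L : eqType) (J : {set I})
    (lab : I -> L) (W : Omega -> L) (P : I -> Omega -> R) (Q : Omega -> R)
    (r : R) :
  {in J &, injective lab} -> 0 <= r ->
  (forall j w, j \in J -> 0 <= P j w) ->
  (forall j, j \in J -> \sum_w P j w = 1) ->
  (forall w, 0 <= Q w) -> \sum_w Q w = 1 ->
  #|J|%:R - r - \sum_(j in J) \sum_(w | r * Q w < P j w) P j w <=
  \sum_(j in J) \sum_(w | W w != lab j) P j w.
Proof.
move=> labI r0 P0 P1 Q0 Q1.
have hit : \sum_(j in J) \sum_(w | W w == lab j) P j w <=
    r + \sum_(j in J) \sum_(w | r * Q w < P j w) P j w.
  apply: (@le_trans _ _ (r * (\sum_(j in J) \sum_(w | W w == lab j) Q w) +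
      \sum_(j in J) \sum_(w | r * Q w < P j w) P j w)); last first.
    rewrite lerD2r -[leRHS]mulr1 ler_wpM2l //; exact: sum_disjoint_le1.
  rewrite big_distrr /= -big_split /=; apply: ler_sum => j jJ.
  rewrite big_distrr /= [leLHS]big_mkcond [X in _ <= X + _]big_mkcond.
  rewrite [X in _ <= _ + X]big_mkcond -big_split /=; apply: ler_sum => w _.
  have := P0 j w jJ; have := mulr_ge0 r0 (Q0 w).
  by case: ifP => _; case: ltP; lra.
suff -> : #|J|%:R = \sum_(j in J) \sum_(w | W w == lab j) P j w +
    \sum_(j in J) \sum_(w | W w != lab j) P j w by lra.
rewrite -big_split -sumr_const; apply: eq_bigr => j jJ.
by rewrite -(P1 j jJ) (bigID (fun w => W w == lab j)).
Qed.

End LikelihoodTest.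

(** * Laws of finite Markov chains and product Bernoulli laws *)

Lemma ln_prod {R : realType} (I : finType) (F : I -> R) :
  (forall i, 0 < F i) -> ln (\prod_i F i) = \sum_i ln (F i).
Proof.
move=> F0; suff [] : 0 < \prod_i F i /\ ln (\prod_i F i) = \sum_i ln (F i) by [].
apply: (big_ind2 (fun u v => 0 < u /\ ln u = v)) => [|u1 v1 u2 v2 [p1 <-] [p2 <-]|i _].
- by rewrite ln1.
- by rewrite mulr_gt0 // lnM.
- by [].
Qed.

Section MarkovPaths.
Context {R : realType} {X : finType}.
Implicit Types (k : X -> X -> R) (x : X) (T : nat).

Definition path_law k x T (w : {ffun 'I_T.+1 -> X}) : R :=
  (w ord0 == x)%:R *
  \prod_(t < T) k (w (widen_ord (leqnSn T) t)) (w (lift ord0 t)).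

Definition path_sum (f : X -> X -> R) T (w : {ffun 'I_T.+1 -> X}) : R :=
  \sum_(t < T) f (w (widen_ord (leqnSn T) t)) (w (lift ord0 t)).

Definition path_cons x T (w : {ffun 'I_T.+1 -> X}) : {ffun 'I_T.+2 -> X} :=
  [ffun i => oapp w x (unlift ord0 i)].

Lemma path_cons0 x T (w : {ffun 'I_T.+1 -> X}) : path_cons x w ord0 = x.
Proof. by rewrite ffunE unlift_none. Qed.

Lemma path_consS x T (w : {ffun 'I_T.+1 -> X}) t :
  path_cons x w (lift ord0 t) = w t.
Proof. by rewrite ffunE liftK. Qed.

Lemma widen_lift0 T (t : 'I_T) :
  widen_ord (leqnSn T.+1) (lift ord0 t) = lift ord0 (widen_ord (leqnSn T) t).
Proof. exact: val_inj. Qed.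

Lemma path_sum_cons f x T (w : {ffun 'I_T.+1 -> X}) :
  path_sum f (path_cons x w) = f x (w ord0) + path_sum f w.
Proof.
rewrite /path_sum big_ord_recl path_consS; congr (f _ _ + _).
  by rewrite -[RHS](path_cons0 x w); congr (path_cons _ _ _); apply: val_inj.
by apply: eq_bigr => t _; rewrite widen_lift0 !path_consS.
Qed.

(** Markov property at the first step: a path from [x] is [x] followed by a path from the next state
    [z]. *)
Lemma sum_path_law_recl k x T (F : {ffun 'I_T.+2 -> X} -> R) :
  \sum_w path_law k x w * F w =
  \sum_z k x z * \sum_w path_law k z w * F (path_cons x w).
Proof.
have -> : \sum_w path_law k x w * F w =
    \sum_(w : {ffun 'I_T.+1 -> X}) (k x (w ord0) *
      \prod_(t < T) k (w (widen_ord (leqnSn T) t)) (w (lift ord0 t))) *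
      F (path_cons x w).
  rewrite (bigID (fun w : {ffun _ -> X} => w ord0 == x)) /=.
  rewrite [X in _ + X]big1 ?addr0; last first.
    by move=> w /negPf w0; rewrite /path_law w0 !mul0r.
  rewrite (reindex_onto (path_cons x (T := T))
    (fun w => [ffun t => w (lift ord0 t)])) /=; last first.
    move=> w /eqP w0; apply/ffunP => i; rewrite ffunE.
    by case: unliftP => [j|] ->; rewrite /= ?ffunE.
  rewrite (eq_bigl xpredT) => [|w]; last first.
    rewrite path_cons0 eqxx /=; apply/eqP/ffunP => t.
    by rewrite ffunE path_consS.
  apply: eq_bigr => w _; congr (_ * _).
  rewrite /path_law path_cons0 eqxx mul1r big_ord_recl path_consS.
  congr (k _ _ * _).
    by rewrite -[RHS](path_cons0 x w); congr (path_cons _ _ _); apply: val_inj.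
  by apply: eq_bigr => t _; rewrite widen_lift0 !path_consS.
under [RHS]eq_bigr do rewrite big_distrr /=.
rewrite exchange_big /=; apply: eq_bigr => w _.
rewrite (bigD1 (w ord0)) //= /path_law eqxx mul1r [X in _ + X]big1 ?addr0 ?mulrA // => z.
by rewrite eq_sym => /negPf ->; rewrite !mul0r mulr0.
Qed.

Definition stochastic k :=
  (forall y z, 0 <= k y z) /\ (forall y, \sum_z k y z = 1).

Lemma path_law_ge0 k x T (w : {ffun 'I_T.+1 -> X}) :
  stochastic k -> 0 <= path_law k x w.
Proof. by move=> [k0 _]; rewrite mulr_ge0 ?ler0n // prodr_ge0. Qed.

Lemma sum_path_law k x T : stochastic k ->
  \sum_(w : {ffun 'I_T.+1 -> X}) path_law k x w = 1.
Proof.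
move=> [k0 k1]; elim: T x => [|T IH] x.
  rewrite (bigD1 [ffun=> x]) //= /path_law ffunE eqxx mul1r big_ord0.
  rewrite big1 ?addr0 // => w wx; rewrite big_ord0 mulr1.
  have /negPf -> // : w ord0 != x; apply: contraNneq wx => wx.
  by apply/eqP/ffunP => i; rewrite ffunE (ord1 i).
under eq_bigr do rewrite -[path_law _ _ _]mulr1.
rewrite sum_path_law_recl -[RHS](k1 x); apply: eq_bigr => z _.
by rewrite -[RHS]mulr1 -[X in _ = _ * X](IH z); under [in LHS]eq_bigr do rewrite mulr1.
Qed.

Lemma path_law_dominated k k' x T (w : {ffun 'I_T.+1 -> X}) :
  (forall y z, k' y z = 0 -> k y z = 0) ->
  path_law k' x w = 0 -> path_law k x w = 0.
Proof.
move=> kk' /eqP; rewrite /path_law mulf_eq0 => /orP[/eqP->|]; first by rewrite mul0r.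
move=> /prodf_eq0[t _ /eqP /kk' kt].
by apply/eqP; rewrite mulf_eq0; apply/orP; right; apply/prodf_eq0; exists t; rewrite ?kt.
Qed.

(** Chain rule: on paths of positive weight the log-likelihood ratio is the sum of the one-step
    ratios. *)
Lemma kl_path_law k k' x T : stochastic k -> stochastic k' ->
  (forall y z, k' y z = 0 -> k y z = 0) ->
  kl (path_law k x (T := T)) (path_law k' x (T := T)) =
  \sum_(w : {ffun 'I_T.+1 -> X})
    path_law k x w * path_sum (fun y z => ln (k y z / k' y z)) w.
Proof.
move=> [k0 _] [k'0 _] kk'; apply: eq_bigr => w _.
have [->|] := eqVneq (path_law k x w) 0; first by rewrite !mul0r.
rewrite {1}/path_law mulf_eq0 negb_or => /andP[w0 wk].
have {w0} w0 : w ord0 == x by move: w0; case: (_ == x); rewrite ?eqxx.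
have kt t : 0 < k (w (widen_ord (leqnSn T) t)) (w (lift ord0 t)).
  by rewrite lt_neqAle eq_sym k0 andbT; move/prodf_neq0: wk; apply.
have k't t : 0 < k' (w (widen_ord (leqnSn T) t)) (w (lift ord0 t)).
  rewrite lt_neqAle eq_sym k'0 andbT; apply/eqP => /kk' kt0.
  by have := kt t; rewrite kt0 ltxx.
congr (_ * _); rewrite /path_law w0 !mul1r -prodf_div ln_prod //.
by move=> t; rewrite divr_gt0.
Qed.

(** Induction on [T] by the first step. That step starts at the fixed state [x] and costs [g x];
    later ones start at a random state, so only the bound [G] on the mean of [g] after a transition
    enters. *)
Lemma path_sum_le k f (g : X -> R) (G : R) x T : stochastic k ->
  (forall y, \sum_z k y z * f y z <= g y) -> (forall y, 0 <= g y) ->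
  (forall y, \sum_z k y z * g z <= G) ->
  \sum_(w : {ffun 'I_T.+1 -> X}) path_law k x w * path_sum f w <= g x + T%:R * G.
Proof.
move=> kS fg g0 gG; have [k0 k1] := kS; elim: T x => [|T IH] x.
  rewrite big1 ?mul0r ?addr0 // => w _.
  by rewrite /path_sum big_ord0 mulr0.
rewrite sum_path_law_recl.
have -> : \sum_z k x z * (\sum_(w : {ffun 'I_T.+1 -> X})
      path_law k z w * path_sum f (path_cons x w)) =
    \sum_z k x z * f x z + \sum_z k x z * (\sum_(w : {ffun 'I_T.+1 -> X})
      path_law k z w * path_sum f w).
  rewrite -big_split /=; apply: eq_bigr => z _; rewrite -mulrDr; congr (_ * _).
  under eq_bigr do rewrite path_sum_cons mulrDr.
  rewrite big_split /=; congr (_ + _).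
  rewrite -[RHS]mul1r -(sum_path_law z T kS) big_distrl /=; apply: eq_bigr => w _.
  rewrite /path_law; case: eqP => [->|] //; by rewrite !mul0r.
apply: lerD => //; apply: (@le_trans _ _ (\sum_z k x z * (g z + T%:R * G))).
  by apply: ler_sum => z _; rewrite ler_wpM2l.
under eq_bigr do rewrite mulrDr.
by rewrite big_split /= -big_distrl /= k1 mulrSr mulrDl !mul1r addrC lerD2l.
Qed.

End MarkovPaths.

(** * Product Bernoulli laws and resampling of one coordinate *)

Section ProductBernoulli.
Context {R : realType} {N : nat}.
Implicit Types (a b : 'I_N -> R) (z : state N).

Definition prod_bernoulli a z : R := \prod_i bernoulli_pmf (a i) (z i).

Lemma bernoulli_pmfD (q : R) c : bernoulli_pmf q c + bernoulli_pmf q (~~ c) = 1.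
Proof. by case: c; rewrite /= ?subrK // addrC subrK. Qed.

Lemma sum_prod_bernoulli a : \sum_z prod_bernoulli a z = 1.
Proof.
rewrite -(bigA_distr_bigA (fun i c => bernoulli_pmf (a i) c)) big1 // => i _.
by rewrite big_bool; exact: (bernoulli_pmfD (a i) true).
Qed.

Lemma prod_bernoulli_ge0 a z : (forall i, 0 <= a i <= 1) -> 0 <= prod_bernoulli a z.
Proof. by move=> a01; apply: prodr_ge0 => i _; apply: bernoulli_pmf_ge0. Qed.

Definition set_coord z (j : 'I_N) (c : bool) : state N :=
  [ffun i => if i == j then c else z i].

Lemma set_coord_id z j : set_coord z j (z j) = z.
Proof. by apply/ffunP => i; rewrite ffunE; case: eqP => [->|]. Qed.

Lemma set_coordK z j c c' : set_coord (set_coord z j c) j c' = set_coord z j c'.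
Proof. by apply/ffunP => i; rewrite !ffunE; case: eqP. Qed.

Lemma set_coord_eq z j c : set_coord z j c j = c.
Proof. by rewrite ffunE eqxx. Qed.

Lemma prod_bernoulli_set_coord a z j c :
  prod_bernoulli a (set_coord z j c) =
  bernoulli_pmf (a j) c * \prod_(i | i != j) bernoulli_pmf (a i) (z i).
Proof.
rewrite /prod_bernoulli (bigD1 j) //= set_coord_eq; congr (_ * _).
by apply: eq_bigr => i /negPf ij; rewrite ffunE ij.
Qed.

(** Independence of coordinate [j]: flipping it pairs the states with [z j = c] with the others, and
    the two Bernoulli weights of a pair add up to 1. *)
Lemma sum_prod_bernoulli_coord a (j : 'I_N) (c : bool) (F : state N -> R) :
  \sum_(z : state N | z j == c) prod_bernoulli a z * F z =
  bernoulli_pmf (a j) c * \sum_z prod_bernoulli a z * F (set_coord z j c).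
Proof.
rewrite [in RHS](bigID (fun z : state N => z j == c)) /=.
have -> : \sum_(z : state N | z j != c) prod_bernoulli a z * F (set_coord z j c) =
    \sum_(z : state N | z j == c) prod_bernoulli a (set_coord z j (~~ c)) * F z.
  rewrite (reindex_onto (fun z => set_coord z j (~~ c)) (fun z => set_coord z j c)).
    apply: eq_big => [z|z /andP[_ /eqP]].
      rewrite set_coord_eq set_coordK (_ : ~~ c != c) /=; last by case: c.
      apply/eqP/eqP => [<-|zj]; first by rewrite set_coord_eq.
      by rewrite -{1}zj set_coord_id.
    by rewrite set_coordK => ->.
  move=> z zj; rewrite set_coordK.
  have -> : ~~ c = z j by move: zj; case: c; case: (z j).
  exact: set_coord_id.
rewrite -big_split big_distrr /=; apply: eq_bigr => z /eqP zj.
have zE : set_coord z j c = z by rewrite -zj set_coord_id.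
have pz : prod_bernoulli a z =
    bernoulli_pmf (a j) c * \prod_(i | i != j) bernoulli_pmf (a i) (z i).
  by rewrite -{1}zE prod_bernoulli_set_coord.
rewrite zE pz prod_bernoulli_set_coord -mulrDl -mulrDl.
by rewrite bernoulli_pmfD mul1r mulrA.
Qed.

Lemma sum_prod_bernoulli_marginal a (j : 'I_N) (f : bool -> R) :
  \sum_z prod_bernoulli a z * f (z j) = a j * f true + (1 - a j) * f false.
Proof.
have part c : \sum_(z : state N | z j == c) prod_bernoulli a z * f (z j) =
    bernoulli_pmf (a j) c * f c.
  transitivity (\sum_(z : state N | z j == c) prod_bernoulli a z * f c).
    by apply: eq_bigr => z /eqP ->.
  rewrite sum_prod_bernoulli_coord -big_distrl /= sum_prod_bernoulli.
  by rewrite mul1r.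
rewrite (bigID (fun z : state N => z j == true)) /= part; congr (_ + _).
by rewrite -[RHS](part false); apply: eq_bigl => z; case: (z j).
Qed.

Lemma prod_bernoulli_dominated a b z :
  (forall i c, bernoulli_pmf (b i) c = 0 -> bernoulli_pmf (a i) c = 0) ->
  prod_bernoulli b z = 0 -> prod_bernoulli a z = 0.
Proof.
move=> ab /eqP/prodf_eq0[i _ /eqP bi]; apply/eqP/prodf_eq0; exists i => //.
by rewrite ab.
Qed.

Lemma kl_prod_bernoulli a b :
  (forall i, 0 <= a i <= 1) -> (forall i, 0 <= b i <= 1) ->
  (forall i c, bernoulli_pmf (b i) c = 0 -> bernoulli_pmf (a i) c = 0) ->
  kl (prod_bernoulli a) (prod_bernoulli b) =
  \sum_i (a i * ln (a i / b i) + (1 - a i) * ln ((1 - a i) / (1 - b i))).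
Proof.
move=> a01 b01 ab.
under [RHS]eq_bigr => i _ do rewrite -(sum_prod_bernoulli_marginal a i
  (fun c => ln (bernoulli_pmf (a i) c / bernoulli_pmf (b i) c))).
rewrite exchange_big /=; apply: eq_bigr => z _; rewrite -big_distrr /=.
have [->|az] := eqVneq (prod_bernoulli a z) 0; first by rewrite !mul0r.
have ai i : 0 < bernoulli_pmf (a i) (z i).
  rewrite lt_neqAle eq_sym bernoulli_pmf_ge0 // andbT.
  by move/prodf_neq0: az; apply.
have bi i : 0 < bernoulli_pmf (b i) (z i).
  rewrite lt_neqAle eq_sym bernoulli_pmf_ge0 // andbT; apply/eqP => /ab h.
  by have := ai i; rewrite h ltxx.
congr (_ * _); rewrite /prod_bernoulli -prodf_div ln_prod // => i.
by rewrite divr_gt0.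
Qed.

(* Resampling coordinate [j] or coordinate [k] to [c] changes the number of
   coordinates equal to [c] by at most one, so both ratios are comparable up
   to a factor 2; summing over [k] gives 1. *)
Lemma mean_share_le a (c : bool) (J : {set 'I_N}) (j : 'I_N) : j \in J ->
  (forall i, 0 <= a i <= 1) ->
  (\sum_(z : state N | z j == c) prod_bernoulli a z / (\sum_(k in J) (z k == c)%:R)) *
    (\sum_(k in J) bernoulli_pmf (a k) c) <= 2 * bernoulli_pmf (a j) c.
Proof.
move=> jJ a01; set Z := fun z : state N => \sum_(k in J) (z k == c)%:R : R.
pose E k := \sum_(z : state N | z k == c) prod_bernoulli a z / Z z.
have EE k : E k = bernoulli_pmf (a k) c *
    \sum_z prod_bernoulli a z / Z (set_coord z k c).
  by rewrite -(sum_prod_bernoulli_coord a k c (fun z => (Z z)^-1)).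
have Z0 z : 0 <= Z z by apply: sumr_ge0.
have sumE : \sum_(k in J) E k <= 1.
  rewrite /E; under eq_bigr do rewrite big_mkcond /=.
  rewrite exchange_big /= -(sum_prod_bernoulli a); apply: ler_sum => z _.
  have -> : \sum_(k in J) (if z k == c then prod_bernoulli a z / Z z else 0) =
      prod_bernoulli a z * (Z z / Z z).
    rewrite mulrA (mulrAC _ (Z z)) {2}/Z big_distrr /=; apply: eq_bigr => k _.
    by case: (z k == c); rewrite ?mulr1 ?mulr0.
  rewrite -[leRHS]mulr1 ler_wpM2l ?prod_bernoulli_ge0 //.
  have [->|?] := eqVneq (Z z) 0; first by rewrite mul0r.
  by rewrite divff.
have comp z k : k \in J -> (Z (set_coord z j c))^-1 <= 2 * (Z (set_coord z k c))^-1.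
  move=> kJ.
  have Zset i : i \in J -> Z (set_coord z i c) = 1 + \sum_(l in J | l != i) (z l == c)%:R.
    move=> iJ; rewrite /Z (bigD1 i) //= set_coord_eq eqxx; congr (_ + _).
    by apply: eq_bigr => l /andP[_ /negPf li]; rewrite ffunE li.
  (* Values at least 1 turn an additive discrepancy of at most 1 into a factor 2. *)
  have Zj1 : 1 <= Z (set_coord z j c).
    by rewrite Zset // lerDl sumr_ge0.
  have Zk1 : 1 <= Z (set_coord z k c).
    by rewrite Zset // lerDl sumr_ge0.
  have Zle i : i \in J -> Z z <= Z (set_coord z i c) <= Z z + 1.
    move=> iJ; rewrite Zset // {1 2}/Z (bigD1 i) //=.
    set A := \sum_(_ in _ | _) _; have A0 : 0 <= A by apply: sumr_ge0.
    by case: eqP => _ /=; apply/andP; split; lra.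
  have /andP[? ?] := Zle j jJ; have /andP[? ?] := Zle k kJ.
  by rewrite ler_pdivlMr ?ler_pdivrMl; lra.
rewrite -/(E j) EE -mulrA [leRHS]mulrC; apply: ler_wpM2l.
  exact: bernoulli_pmf_ge0.
apply: (@le_trans _ _ (2 * \sum_(k in J) E k)); last lra.
rewrite mulrC big_distrl big_distrr /=; apply: ler_sum => k kJ.
rewrite EE mulrCA ler_wpM2l ?bernoulli_pmf_ge0 // big_distrr /=.
apply: ler_sum => z _; rewrite mulrCA ler_wpM2l ?prod_bernoulli_ge0 //.
exact: comp.
Qed.

End ProductBernoulli.

(** * The star of hypotheses *)

Lemma sum_share_le1 {R : realFieldType} (I : finType) (J : {set I}) (f : I -> R) :
  \sum_(j in J) f j / (\sum_(k in J) f k) <= 1.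
Proof.
rewrite -big_distrl /=; have [->|?] := eqVneq (\sum_(k in J) f k) 0.
  by rewrite mul0r.
by rewrite divff.
Qed.

Section StarFamily.
Context {R : realType}.
Variables (lambda mu : R) (N : nat) (th : 'M[bool]_N).
Hypotheses (mu_gt0 : 0 < mu) (mu_le : mu <= lambda) (lambda_lt1 : lambda < 1).
Hypothesis (N_gt0 : (0 < N)%N).

Let kappa : R := (1 - lambda) / N%:R.

Let N_gt0' : 0 < N%:R :> R. Proof. by rewrite ltr0n. Qed.

Let kappa_gt0 : 0 < kappa. Proof. by rewrite divr_gt0 // subr_gt0. Qed.

Let kappaN : kappa * N%:R = 1 - lambda.
Proof. by rewrite divfK // gt_eqF. Qed.

(** Counting inactive edges measures the distance of the success probability from 1, where the
    divergence of a coordinate degenerates. *)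
Definition inactive (S : {set 'I_N}) (i : 'I_N) (y : state N) : R :=
  \sum_k (~~ (th i k && (y k == (k \in S))))%:R.

Lemma success_probE S i y :
  success_prob lambda mu th S i y = 1 - (lambda - mu) - kappa * inactive S i y.
Proof.
suff act : \sum_(j in S) (th i j)%:R * (y j)%:R +
    \sum_(j in ~: S) (th i j)%:R * (1 - (y j)%:R) = N%:R - inactive S i y.
  rewrite /success_prob act -/kappa mulrBr kappaN; lra.
rewrite -[N in N%:R]card_ord -sumr_const /inactive -sumrB.
rewrite [RHS](bigID (mem S)) /=; congr (_ + _).
  apply: eq_bigr => k ->; case: (th i k); case: (y k) => /=;
  by rewrite ?(mul0r, mul1r, subrr, subr0).
apply: eq_big => [k|k]; rewrite inE // => /negPf ->.
by case: (th i k); case: (y k); rewrite /= ?(mul0r, mul1r, subrr, subr0).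
Qed.

Lemma inactive_ge0 S i y : 0 <= inactive S i y.
Proof. exact: sumr_ge0. Qed.

Lemma inactive_leN S i y : inactive S i y <= N%:R.
Proof.
rewrite -[N in N%:R]card_ord -sumr_const; apply: ler_sum => k _.
by case: (~~ _).
Qed.

Lemma success_prob_itv S i y : mu <= success_prob lambda mu th S i y <= 1.
Proof.
have ml := mu_le; have l1 := lambda_lt1; have m0 := mu_gt0.
have := kappaN; rewrite success_probE => kN.
have := ler_wpM2l (ltW kappa_gt0) (inactive_leN S i y).
have := mulr_ge0 (ltW kappa_gt0) (inactive_ge0 S i y).
by move=> ? ?; apply/andP; split; lra.
Qed.

Lemma success_prob01 S i y : 0 <= success_prob lambda mu th S i y <= 1.
Proof.
have /andP[h ->] := success_prob_itv S i y.
by rewrite (le_trans _ h) // ltW.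
Qed.

Lemma stochastic_transition S : stochastic (transition lambda mu th S).
Proof.
split=> [y z|y]; last exact: sum_prod_bernoulli.
by apply: prod_bernoulli_ge0 => i; exact: success_prob01.
Qed.

(** * The toggled hypotheses and their averaged chain *)

Variables (S0 : {set 'I_N}) (c : bool).

Definition toggle (j : 'I_N) : {set 'I_N} :=
  [set k | (k \in S0) (+) (k == j)]%SET.

Definition core : {set 'I_N} := [set k | (k \in S0) == c]%SET.

Hypothesis core_gt1 : (1 < #|core|)%N.

Let M : R := #|core|%:R.

Let M_ge2 : 2 <= M. Proof. by rewrite ler_nat. Qed.

Definition avg_prob (i : 'I_N) (y : state N) : R :=
  (\sum_(j in core) success_prob lambda mu th (toggle j) i y) / M.

Lemma avg_const (a : R) : (\sum_(j in core) a) / M = a.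
Proof. rewrite sumr_const -mulr_natr mulfK // gt_eqF //; have := M_ge2; lra. Qed.

Lemma avg_prob_itv i y : mu <= avg_prob i y <= 1.
Proof.
have M0 : 0 <= M^-1 by rewrite invr_ge0 ler0n.
apply/andP; split; [rewrite -[leLHS]avg_const | rewrite -[leRHS]avg_const];
by apply: ler_wpM2r => //; apply: ler_sum => j _;
   case/andP: (success_prob_itv (toggle j) i y).
Qed.

Lemma avg_prob01 i y : 0 <= avg_prob i y <= 1.
Proof.
have /andP[h ->] := avg_prob_itv i y.
by rewrite (le_trans _ h) // ltW.
Qed.

(** An average of numbers at most 1 is 1 only if all of them are; this yields absolute continuity
    with respect to the averaged chain. *)
Lemma avg_prob_eq1 j i y : j \in core -> avg_prob i y = 1 ->
  success_prob lambda mu th (toggle j) i y = 1.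
Proof.
move=> jJ q1; have M0 : M != 0 by rewrite gt_eqF //; have := M_ge2; lra.
have : \sum_(k in core) (1 - success_prob lambda mu th (toggle k) i y) = 0.
  apply: (mulIf (invr_neq0 M0)); rewrite mul0r sumrB mulrBl avg_const.
  by rewrite -/(avg_prob i y) q1 subrr.
move=> /eqP; rewrite psumr_eq0; last first.
  by move=> k _; rewrite subr_ge0; case/andP: (success_prob_itv (toggle k) i y).
by move=> /allP /(_ j); rewrite mem_index_enum jJ subr_eq0 => /(_ isT) /eqP.
Qed.

Definition avg_transition (y z : state N) : R :=
  prod_bernoulli (avg_prob ^~ y) z.

Lemma stochastic_avg_transition : stochastic avg_transition.
Proof.
split=> [y z|y]; last exact: sum_prod_bernoulli.
by apply: prod_bernoulli_ge0 => i; exact: avg_prob01.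
Qed.

Lemma bernoulli_avg_dominated j i y b : j \in core ->
  bernoulli_pmf (avg_prob i y) b = 0 ->
  bernoulli_pmf (success_prob lambda mu th (toggle j) i y) b = 0.
Proof.
have ml := mu_le; have l1 := lambda_lt1; have m0 := mu_gt0.
move=> jJ; case: b => /= [q0|/eqP].
  by have /andP[+ _] := avg_prob_itv i y; rewrite q0; lra.
by rewrite subr_eq0 eq_sym => /eqP/(avg_prob_eq1 jJ) ->; rewrite subrr.
Qed.

Lemma avg_transition_dominated j y z : j \in core ->
  avg_transition y z = 0 -> transition lambda mu th (toggle j) y z = 0.
Proof.
move=> jJ; apply: prod_bernoulli_dominated => i b.
exact: bernoulli_avg_dominated.
Qed.

(* For [k] in [core], inactivity of the edge from [k] to [i] under [S0]. *)
Definition idle (i k : 'I_N) (y : state N) : R :=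
  (~~ (th i k && (y k == c)))%:R.

Definition idle_sum (i : 'I_N) (y : state N) : R := \sum_(k in core) idle i k y.

(* One plus the number of edges into [i] gained by toggling [j] in [core]; the
   offset makes it nonnegative and at most [2 * idle i j y]. *)
Definition shift (i j : 'I_N) (y : state N) : R :=
  (~~ th i j)%:R + 2 * (th i j && (y j != c))%:R.

Lemma inactive_toggle i j y : j \in core ->
  inactive (toggle j) i y = inactive S0 i y + 1 - shift i j y.
Proof.
rewrite inE => /eqP jc; rewrite /inactive !(bigD1 (P := xpredT) j) //=.
set A := \sum_(_ | _) _; set B := \sum_(_ | _) _.
have -> : A = B.
  by apply: eq_bigr => k /negPf kj; rewrite inE kj addbF.
rewrite inE eqxx addbT jc /shift; case: (th i j); case: (y j); case: c => /=; lra.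
Qed.

Lemma shift_ge0 i j y : 0 <= shift i j y.
Proof. by rewrite addr_ge0 // mulr_ge0. Qed.

Lemma shift_le i j y : shift i j y <= 2 * idle i j y.
Proof.
rewrite /shift /idle; case: (th i j) => /=; last lra.
by case: (_ == _) => /=; lra.
Qed.

Lemma shift_le1 i j y : shift i j y <= 1 + idle i j y.
Proof.
rewrite /shift /idle; case: (th i j) => /=; last lra.
by case: (_ == _) => /=; lra.
Qed.

Definition avg_shift i y := (\sum_(j in core) shift i j y) / M.

Lemma avg_probE i y :
  avg_prob i y = 1 - (lambda - mu) - kappa * (inactive S0 i y + 1 - avg_shift i y).
Proof.
have ml := mu_le; have l1 := lambda_lt1; have m0 := mu_gt0.
have -> : avg_prob i y = (\sum_(j in core) (1 - (lambda - mu) -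
    kappa * (inactive S0 i y + 1) + kappa * shift i j y)) / M.
  congr (_ / _); apply: eq_bigr => j jJ.
  rewrite success_probE inactive_toggle //; lra.
rewrite big_split /= mulrDl avg_const -big_distrr /= /avg_shift.
ring.
Qed.

Lemma idle_sum_le i y : idle_sum i y <= inactive S0 i y.
Proof.
rewrite /inactive (bigID (mem core)) /= -[leLHS]addr0; apply: lerD.
  by apply: ler_sum => k; rewrite inE /idle => /eqP ->.
exact: sumr_ge0.
Qed.

Lemma idle_le_sum i j y : j \in core -> idle i j y <= idle_sum i y.
Proof.
by move=> jJ; rewrite /idle_sum (bigD1 j) //= lerDl sumr_ge0.
Qed.

Lemma idle_sum_leM i y : idle_sum i y <= M.
Proof.
rewrite /M -sumr_const; apply: ler_sum => k _.
by rewrite /idle; case: (~~ _).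
Qed.

(** The mean shift is at most [1 + idle_sum i y / M], and [M >= 2] leaves half of [idle_sum]. This
    controls the denominator of the chi-square bound. *)
Lemma subr_avg_prob_ge i y : kappa * (idle_sum i y / 2) <= 1 - avg_prob i y.
Proof.
have ml := mu_le; have l1 := lambda_lt1; have m0 := mu_gt0.
have M2 := M_ge2; have M0 : 0 < M by lra.
rewrite avg_probE; have H := idle_sum_le i y.
have sh : avg_shift i y <= 1 + idle_sum i y / M.
  rewrite /avg_shift -[1]avg_const -mulrDl ler_wpM2r ?invr_ge0 ?(ltW M0) //.
  by rewrite /idle_sum -big_split /=; apply: ler_sum => j _; exact: shift_le1.
have HM : idle_sum i y / M <= idle_sum i y / 2.
  by apply: ler_wpM2l; [exact: sumr_ge0 | rewrite lef_pV2 ?posrE //; lra].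
have := ler_wpM2l (ltW kappa_gt0) (_ : idle_sum i y / 2 <=
  inactive S0 i y + 1 - avg_shift i y).
by move=> /(_ ltac:(lra)) ?; lra.
Qed.

(** With [h] the idle indicator and [H] its sum, the numerator is at most
    [kappa ^ 2 * (4 * h + 4 * H / M)] and the denominator at least [mu * kappa * H / 2]. One factor
    [kappa <= 1 / N] survives, and 8 is 4 divided by 1/2. *)
Lemma coordinate_divergence_le j i y : j \in core ->
  let a := success_prob lambda mu th (toggle j) i y in
  (a - avg_prob i y) ^+ 2 / (avg_prob i y * (1 - avg_prob i y)) <=
  8 / (mu * N%:R) * (idle i j y / idle_sum i y + M^-1).
Proof.
have ml := mu_le; have l1 := lambda_lt1; have m0 := mu_gt0.
move=> jJ /=.
have M2 := M_ge2; have M0 : 0 < M by lra.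
have aq : success_prob lambda mu th (toggle j) i y - avg_prob i y =
    kappa * (shift i j y - avg_shift i y).
  rewrite success_probE inactive_toggle // avg_probE; lra.
have s0 := shift_ge0 i j y; have s2 := shift_le i j y.
have t0 : 0 <= avg_shift i y.
  by rewrite divr_ge0 ?(ltW M0) // sumr_ge0 // => k _; exact: shift_ge0.
have t2 : avg_shift i y <= 2 * (idle_sum i y / M).
  rewrite mulrA ler_wpM2r ?invr_ge0 ?(ltW M0) // /idle_sum big_distrr /=.
  by apply: ler_sum => k _; exact: shift_le.
have hh : idle i j y ^+ 2 = idle i j y.
  by rewrite /idle; case: (~~ _); rewrite ?expr1n ?expr0n.
have h0 : 0 <= idle i j y by [].
have hH := idle_le_sum i y jJ; have HM := idle_sum_leM i y.
have /andP[qmu _] := avg_prob_itv i y; have q1 := subr_avg_prob_ge i y.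
rewrite aq; move: (shift i j y) (avg_shift i y) (idle i j y) (idle_sum i y)
  (avg_prob i y) s0 s2 t0 t2 hh h0 hH HM qmu q1 => s t h H q.
move=> s0 s2 t0 t2 hh h0 hH HM qmu q1 {aq}.
(* If nothing is idle, both deviations vanish and the two success probabilities agree. *)
have [H0|HN] := eqVneq H 0.
  have -> : s = 0 by lra.
  have -> : t = 0 by rewrite H0 mul0r mulr0 in t2; lra.
  rewrite subrr mulr0 expr0n mul0r H0 invr0 mulr0 add0r mulr_ge0 //.
    by rewrite divr_ge0 // mulr_ge0 ?ltW.
  by rewrite invr_ge0 ltW.
have {}HN : 0 < H by rewrite lt_neqAle eq_sym HN; lra.
have rho0 : 0 <= H / M by rewrite divr_ge0 ?(ltW HN) ?(ltW M0).
have rho1 : H / M <= 1 by rewrite ler_pdivrMr ?mul1r.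
have kH : 0 < kappa * (H / 2) by rewrite mulr_gt0 // divr_gt0.
have sq : (s - t) ^+ 2 <= 4 * h + 4 * (H / M).
  have : s ^+ 2 <= (2 * h) ^+ 2 by rewrite ler_sqr ?nnegrE //; lra.
  have : t ^+ 2 <= (2 * (H / M)) ^+ 2 by rewrite ler_sqr ?nnegrE //; lra.
  have : (H / M) ^+ 2 <= H / M by rewrite expr2 -[leRHS]mulr1 ler_wpM2l.
  have := mulr_ge0 s0 t0.
  rewrite !exprMn hh; nra.
apply: (@le_trans _ _ ((kappa ^+ 2 * (4 * h + 4 * (H / M))) /
    (mu * (kappa * (H / 2))))).
  rewrite exprMn; apply: ler_pM.
  - by rewrite mulr_ge0 ?sqr_ge0.
  - by rewrite invr_ge0 mulr_ge0 //; lra.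
  - by rewrite ler_wpM2l ?sqr_ge0.
  - have d1 : 0 < mu * (kappa * (H / 2)) by exact: mulr_gt0.
    have d2 : mu * (kappa * (H / 2)) <= q * (1 - q) by apply: ler_pM; lra.
    by rewrite lef_pV2 ?posrE //; lra.
have -> : kappa ^+ 2 * (4 * h + 4 * (H / M)) / (mu * (kappa * (H / 2))) =
    (8 / (mu * N%:R) * (h / H + M^-1)) * (kappa * N%:R).
  by field; rewrite !gt_eqF.
rewrite -[leRHS]mulr1 ler_wpM2l //; last by rewrite kappaN; lra.
rewrite mulr_ge0 ?addr_ge0 ?divr_ge0 ?invr_ge0 ?mulr_ge0 //; lra.
Qed.

(** * Shares of a node among missing edges and mismatched states *)

Definition column_share (j : 'I_N) : R :=
  \sum_i (~~ th i j)%:R / (\sum_(k in core) (~~ th i k)%:R).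

Definition state_share (j : 'I_N) (y : state N) : R :=
  (y j == ~~ c)%:R / (\sum_(k in core) (y k == ~~ c)%:R).

(** An edge is idle if and only if it is missing or its source is mismatched. The count of either
    kind is at most [idle_sum], so using it as denominator only increases the quotient. *)
Lemma idle_share_le i j y : j \in core -> idle i j y / idle_sum i y <=
  (~~ th i j)%:R / (\sum_(k in core) (~~ th i k)%:R) + state_share j y.
Proof.
move=> jJ; have H0 : 0 <= idle_sum i y by exact: sumr_ge0.
have share (f : 'I_N -> bool) : (forall k, (f k)%:R <= idle i k y) ->
    (f j)%:R / idle_sum i y <= (f j)%:R / (\sum_(k in core) (f k)%:R).
  move=> fi; case fj : (f j) => //=; last by rewrite !mul0r.
  have F1 : 1 <= \sum_(k in core) (f k)%:R :> R.
    by rewrite (bigD1 j) //= fj lerDl sumr_ge0.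
  have FH : \sum_(k in core) (f k)%:R <= idle_sum i y :> R.
    by apply: ler_sum => k _; exact: fi.
  by rewrite !mul1r lef_pV2 ?posrE //; lra.
apply: (@le_trans _ _ (((~~ th i j)%:R + (y j == ~~ c)%:R) / idle_sum i y)).
  apply: ler_wpM2r; first by rewrite invr_ge0.
  rewrite /idle; case: (th i j); case: (y j); case: c => //=; lra.
rewrite mulrDl; apply: lerD.
  apply: (share (fun k => ~~ th i k)) => k; rewrite /idle.
  by case: (th i k); case: (_ == _).
apply: (share (fun k => y k == ~~ c)) => k; rewrite /idle.
by case: (th i k); case: (y k); case: c.
Qed.

Definition step_bound (j : 'I_N) (y : state N) : R :=
  8 / (mu * N%:R) * (N%:R / M + column_share j + N%:R * state_share j y).

Lemma step_bound_ge0 j y : 0 <= step_bound j y.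
Proof.
apply: mulr_ge0; first by rewrite divr_ge0 // mulr_ge0 ?ltW.
rewrite !addr_ge0 ?divr_ge0 ?mulr_ge0 //.
- by apply: sumr_ge0 => i _; rewrite divr_ge0 ?sumr_ge0.
- by rewrite invr_ge0 sumr_ge0.
Qed.

Lemma step_divergence_le j y : j \in core ->
  kl (transition lambda mu th (toggle j) y) (avg_transition y) <=
  step_bound j y.
Proof.
move=> jJ; rewrite /avg_transition.
rewrite (_ : transition _ _ _ _ _ =
  prod_bernoulli (fun i => success_prob lambda mu th (toggle j) i y)) //.
rewrite kl_prod_bernoulli; first last.
- by move=> i b; exact: bernoulli_avg_dominated.
- by move=> i; exact: avg_prob01.
- by move=> i; exact: success_prob01.
apply: (@le_trans _ _ (\sum_i 8 / (mu * N%:R) * (M^-1 +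
   (~~ th i j)%:R / (\sum_(k in core) (~~ th i k)%:R) + state_share j y))).
  apply: ler_sum => i _.
  apply: (le_trans (bernoulli_kl_le (success_prob01 _ _ _) _ (avg_prob_eq1 jJ))).
    by have /andP[h ->] := avg_prob_itv i y; rewrite (lt_le_trans mu_gt0 h).
  apply: (le_trans (coordinate_divergence_le i y jJ)).
  apply: ler_wpM2l; first by rewrite divr_ge0 // mulr_ge0 ?ltW.
  by have := idle_share_le i y jJ; lra.
rewrite -big_distrr /= !big_split /= !sumr_const card_ord.
by rewrite -[M^-1 *+ N]mulr_natl -[state_share j y *+ N]mulr_natl.
Qed.

Definition row_idle (k : 'I_N) : R := \sum_l (~~ th k l)%:R.

(** Unlike [column_share], this concerns the edges entering [j], which govern the next state of
    [j]. *)
Definition row_share (j : 'I_N) : R := row_idle j / (\sum_(k in core) row_idle k).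

Lemma row_idle_ge0 k : 0 <= row_idle k. Proof. exact: sumr_ge0. Qed.

Lemma row_share_ge0 j : 0 <= row_share j.
Proof. by rewrite divr_ge0 ?sumr_ge0 // => *; exact: row_idle_ge0. Qed.

(* Up to a factor 2, the number of inactive edges into [k] is [row_idle k] plus
   the number of nodes with a mismatched state, which does not depend on [k]. *)
Lemma mismatch_prob_share_le S y j : j \in core ->
  bernoulli_pmf (success_prob lambda mu th S j y) (~~ c) <=
  (2 / (mu * M) + 2 * row_share j) *
  \sum_(k in core) bernoulli_pmf (success_prob lambda mu th S k y) (~~ c).
Proof.
have ml := mu_le; have l1 := lambda_lt1; have m0 := mu_gt0.
move=> jJ; have M2 := M_ge2; have M0 : 0 < M by lra.
have rs0 := row_share_ge0 j.
(* For [c = false] the mismatched state is 1, whose probability lies between [mu] and 1 at every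
   node. *)
case: c => /=; last first.
  have /andP[_ p1] := success_prob_itv S j y; apply: (le_trans p1).
  have : M * mu <= \sum_(k in core) success_prob lambda mu th S k y.
    rewrite /M mulr_natl -sumr_const; apply: ler_sum => k _.
    by case/andP: (success_prob_itv S k y).
  move=> h; apply: (@le_trans _ _ (2 / (mu * M) * (M * mu))).
    by rewrite (_ : _ * _ = 2) ?ler1n //; field; rewrite !gt_eqF.
  apply: ler_pM => //; first by rewrite divr_ge0 // mulr_ge0 ?ltW.
    by rewrite mulr_ge0 ?(ltW M0) ?(ltW m0).
  by rewrite lerDl mulr_ge0.
pose B : R := \sum_l (y l != (l \in S))%:R.
have B0 : 0 <= B by exact: sumr_ge0.
have up k : inactive S k y <= B + row_idle k.
  rewrite -big_split; apply: ler_sum => l _ /=.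
  by case: (th k l); case: (_ == _) => /=; lra.
have lo k : B + row_idle k <= 2 * inactive S k y.
  rewrite -big_split big_distrr; apply: ler_sum => l _ /=.
  by case: (th k l); case: (_ == _) => /=; lra.
(* [a] is common to all nodes: each failure probability lies between half of
   [a + kappa * row_idle k] and that quantity. *)
pose a := lambda - mu + kappa * B.
have fj : 1 - success_prob lambda mu th S j y <= a + kappa * row_idle j.
  rewrite success_probE; have := ler_wpM2l (ltW kappa_gt0) (up j).
  by rewrite /a mulrDr; lra.
apply: (le_trans fj).
have kB : 0 <= kappa * B by rewrite mulr_ge0 ?(ltW kappa_gt0).
set SR := \sum_(k in core) row_idle k.
have SR0 : 0 <= SR by apply: sumr_ge0 => k _; exact: row_idle_ge0.
have low : M * (a / 2) + kappa * SR / 2 <=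
    \sum_(k in core) (1 - success_prob lambda mu th S k y).
  rewrite /M mulr_natl -sumr_const /SR big_distrr big_distrl -big_split /=.
  apply: ler_sum => k _; rewrite success_probE.
  by have := ler_wpM2l (ltW kappa_gt0) (lo k); rewrite /a mulrDr; lra.
have a0 : 0 <= a by rewrite /a; lra.
have mu1 : 1 <= mu^-1 by rewrite invf_ge1 //; lra.
have c0 : 0 <= 2 / M + 2 * row_share j.
  by apply: addr_ge0; [rewrite divr_ge0 // ltW | rewrite mulr_ge0].
apply: (@le_trans _ _ ((2 / M + 2 * row_share j) *
    (M * (a / 2) + kappa * SR / 2))); last first.
  apply: ler_pM => //; first by rewrite addr_ge0 ?divr_ge0 ?mulr_ge0 ?(ltW kappa_gt0) ?(ltW M0) //; lra.
  rewrite lerD2r invfM [leRHS]mulrA ler_wpM2r ?invr_ge0 ?(ltW M0) //; lra.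
(* Of the four products in the expansion, two yield [a] and at least [kappa * row_idle j]; the other
   two are nonnegative. *)
have e1 : 2 / M * (M * (a / 2)) = a by field; rewrite gt_eqF.
have e2 : kappa * row_idle j <= 2 * row_share j * (kappa * SR / 2).
  rewrite /row_share -/SR; have [SRz|SRn] := eqVneq SR 0.
    have : row_idle j <= SR.
      by rewrite /SR (bigD1 j) //= lerDl sumr_ge0 // => k _; exact: row_idle_ge0.
    rewrite SRz => r0; have -> : row_idle j = 0.
      by apply/le_anti; rewrite r0 row_idle_ge0.
    by rewrite !(mul0r, mulr0).
  by rewrite le_eqVlt; apply/predU1P; left; field.
have e3 : 0 <= 2 / M * (kappa * SR / 2).
  apply: mulr_ge0; first by rewrite divr_ge0 // ltW.
  by rewrite divr_ge0 // mulr_ge0 // ltW.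
have e4 : 0 <= 2 * row_share j * (M * (a / 2)).
  apply: mulr_ge0; first exact: mulr_ge0.
  by rewrite mulr_ge0 ?divr_ge0 // ltW.
rewrite mulrDl !mulrDr e1; lra.
Qed.

(** [mean_share_le] reduces this to the share of [j] in the mismatch probabilities, bounded by
    [mismatch_prob_share_le]; each contributes a factor 2. *)
Lemma mean_state_share_le S y j : j \in core ->
  \sum_z transition lambda mu th S y z * state_share j z <=
  4 / (mu * M) + 4 * row_share j.
Proof.
have ml := mu_le; have l1 := lambda_lt1; have m0 := mu_gt0.
move=> jJ; have M2 := M_ge2; have M0 : 0 < M by lra.
pose a i := success_prob lambda mu th S i y.
have a01 i : 0 <= a i <= 1 by exact: success_prob01.
pose Z (z : state N) : R := \sum_(k in core) (z k == ~~ c)%:R.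
have -> : \sum_z transition lambda mu th S y z * state_share j z =
    \sum_(z : state N | z j == ~~ c) prod_bernoulli a z / Z z.
  rewrite [RHS]big_mkcond; apply: eq_bigr => z _; rewrite /state_share.
  by case: (z j == ~~ c); rewrite ?mul1r // mul0r mulr0.
have rhs0 : 0 <= 2 / (mu * M) + 2 * row_share j.
  apply: addr_ge0; last by rewrite mulr_ge0 // row_share_ge0.
  by rewrite divr_ge0 // mulr_ge0 // ltW.
have share := mismatch_prob_share_le S y jJ.
have := mean_share_le (~~ c) jJ a01; rewrite -/(Z _).
set E := \sum_(z | _) _; set Sg := \sum_(k in core) _ => Eg.
have Sg0 : 0 <= Sg by apply: sumr_ge0 => k _; exact: bernoulli_pmf_ge0.
have [Sgz|SgN] := eqVneq Sg 0.
  have gj : bernoulli_pmf (a j) (~~ c) = 0.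
    apply/le_anti; rewrite bernoulli_pmf_ge0 // andbT.
    by move: share; rewrite -/Sg Sgz mulr0.
  rewrite /E (sum_prod_bernoulli_coord a j (~~ c) (fun z => (Z z)^-1)) gj mul0r.
  lra.
have {}Sg0 : 0 < Sg by rewrite lt_neqAle eq_sym SgN.
rewrite -(ler_pM2r Sg0); apply: (le_trans Eg).
have := ler_wpM2l (ler0n R 2) share; rewrite -/Sg; lra.
Qed.

(** * Divergence of trajectories, summed over the hypotheses *)

Definition later_bound (j : 'I_N) : R :=
  8 / (mu * N%:R) * (N%:R / M + column_share j +
    N%:R * (4 / (mu * M) + 4 * row_share j)).

Lemma mean_step_bound_le S y j : j \in core ->
  \sum_z transition lambda mu th S y z * step_bound j z <= later_bound j.
Proof.
move=> jJ; have [_ t1] := stochastic_transition S.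
have -> : \sum_z transition lambda mu th S y z * step_bound j z =
    8 / (mu * N%:R) * (N%:R / M + column_share j +
      N%:R * \sum_z transition lambda mu th S y z * state_share j z).
  rewrite /step_bound; set C := 8 / _; set D := _ / M + _.
  rewrite -[D in RHS]mul1r -(t1 y) big_distrl [in RHS]big_distrr -big_split.
  by rewrite big_distrr /=; apply: eq_bigr => z _; ring.
apply: ler_wpM2l; first by rewrite divr_ge0 // mulr_ge0 ?ltW.
by rewrite lerD2l ler_wpM2l // mean_state_share_le.
Qed.

Lemma trajectory_divergence_le x T j : j \in core ->
  kl (path_law (transition lambda mu th (toggle j)) x (T := T))
     (path_law avg_transition x (T := T)) <=
  step_bound j x + T%:R * later_bound j.
Proof.
move=> jJ; rewrite kl_path_law.
- apply: path_sum_le.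
  + exact: stochastic_transition.
  + by move=> y; exact: step_divergence_le.
  + by move=> y; exact: step_bound_ge0.
  + by move=> y; exact: mean_step_bound_le.
- exact: stochastic_transition.
- exact: stochastic_avg_transition.
- by move=> y z; exact: avg_transition_dominated.
Qed.

Lemma total_divergence_le x T : (0 < T)%N ->
  \sum_(j in core) kl
    (path_law (transition lambda mu th (toggle j)) x (T := T))
    (path_law avg_transition x (T := T)) <= 104 * T%:R / mu ^+ 2.
Proof.
have ml := mu_le; have l1 := lambda_lt1; have m0 := mu_gt0.
move=> T0; have M2 := M_ge2; have M0 : 0 < M by lra.
have T1 : 1 <= T%:R :> R by rewrite ler1n.
apply: (le_trans (ler_sum _ (fun j jJ => trajectory_divergence_le x T jJ))).
rewrite big_split /= -big_distrr /= /step_bound /later_bound -!big_distrr /=.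
have col : \sum_(j in core) column_share j <= N%:R.
  rewrite exchange_big /= -[N in N%:R]card_ord -sumr_const.
  by apply: ler_sum => i _; exact: sum_share_le1.
have st : \sum_(j in core) state_share j x <= 1 by exact: sum_share_le1.
have row : \sum_(j in core) row_share j <= 1 by exact: sum_share_le1.
rewrite !big_split /= -!big_distrr /= !big_split /= -!big_distrr /=.
have -> : \sum_(i in core) M^-1 = 1.
  by rewrite sumr_const -mulr_natl divff // gt_eqF.
have -> : \sum_(i in core) (mu * M)^-1 = mu^-1.
  by rewrite sumr_const -mulr_natl -/M; field; rewrite !gt_eqF.
rewrite mulr1.
have C0 : 0 <= 8 / (mu * N%:R) by rewrite divr_ge0 // mulr_ge0 ?ltW.
have mu1 : 1 <= mu^-1 by rewrite invf_ge1 //; lra.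
move: (\sum_(j in core) column_share j) (\sum_(j in core) state_share j x)
  (\sum_(j in core) row_share j) col st row => cs ss rs col st row.
(* At the initial time each of the three terms sums to at most [N]; later they give at most
   [N * (2 + 4 / mu + 4) <= N * (10 / mu)]. Then 104 is 8 * 3 + 8 * 10, as [mu <= 1 <= T]. *)
apply: (@le_trans _ _ (8 / (mu * N%:R) * (3 * N%:R) +
   T%:R * (8 / (mu * N%:R) * (N%:R * (10 / mu))))).
  apply: lerD; [|apply: ler_wpM2l => //]; apply: ler_wpM2l => //.
    by have := ler_wpM2l (ltW N_gt0') st; lra.
  have -> : N%:R + cs + N%:R * (4 / mu + 4 * rs) =
     (N%:R + cs) + N%:R * (4 / mu + 4 * rs) by [].
  have h : 2 + (4 / mu + 4 * rs) <= 10 / mu by lra.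
  have := ler_wpM2l (ltW N_gt0') h; rewrite mulrDr; lra.
have -> : 8 / (mu * N%:R) * (3 * N%:R) + T%:R * (8 / (mu * N%:R) * (N%:R * (10 / mu))) =
  (24 * mu + 80 * T%:R) / mu ^+ 2 by field; rewrite !gt_eqF.
apply: ler_wpM2r; first by rewrite invr_ge0 sqr_ge0.
by have := mu_le; have := lambda_lt1; lra.
Qed.

Lemma toggle_inj : injective toggle.
Proof.
move=> j k /setP /(_ j); rewrite !inE eqxx.
by case: (j \in S0) => /=; case: eqP.
Qed.

(** [A] is the total probability that the likelihood ratio exceeds [u]. It depends on [th], but only
    these three bounds enter the final arithmetic. *)
Lemma star_family_error (L : eqType) (lab : 'I_N -> L) x T
    (W : {ffun 'I_T.+1 -> state N} -> L) (u : R) :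
  injective lab -> (0 < T)%N -> 1 <= u ->
  exists A : R, [/\ A <= M, A * log_gap u <= 104 * T%:R / mu ^+ 2 &
    M - u - A <= \sum_(j in core) \sum_(w | W w != lab j)
      path_law (transition lambda mu th (toggle j)) x w].
Proof.
move=> labI T0 u1.
pose P j (w : {ffun 'I_T.+1 -> state N}) :=
  path_law (transition lambda mu th (toggle j)) x w.
pose Q (w : {ffun 'I_T.+1 -> state N}) := path_law avg_transition x w.
have P0 j w : 0 <= P j w by apply: path_law_ge0; exact: stochastic_transition.
have Q0 w : 0 <= Q w by apply: path_law_ge0; exact: stochastic_avg_transition.
have P1 j : \sum_w P j w = 1 by apply: sum_path_law; exact: stochastic_transition.
have Q1 : \sum_w Q w = 1 by apply: sum_path_law; exact: stochastic_avg_transition.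
exists (\sum_(j in core) \sum_(w | u * Q w < P j w) P j w); split.
- rewrite /M -sumr_const; apply: ler_sum => j _; rewrite -(P1 j).
  by rewrite [leLHS]big_mkcond; apply: ler_sum => w _; case: ifP.
- apply: le_trans (total_divergence_le x T0).
  rewrite big_distrl /=; apply: ler_sum => j jJ.
  apply: likelihood_ratio_tail => // w.
  by apply: path_law_dominated => y z; exact: avg_transition_dominated.
- apply: multiple_test_error => //; last lra.
  by move=> j k _ _; exact: labI.
Qed.

End StarFamily.

(** * The minimax bound *)

Section Arithmetic.
Context {R : realType}.

(** The gap is at least [ln u / 2] when [ln u >= 2], which gives the term in [alpha], and at least
    [ln u ^+ 2 / 4] below, which with [a <= 1] gives the square root. *)
Lemma log_gap_tail_le (u a alpha : R) :
  1 < u -> a <= 1 -> 0 <= alpha -> a * log_gap u <= alpha ->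
  a <= (2 * alpha + 2 * Num.sqrt alpha) / ln u.
Proof.
move=> u1 a1 al0 gap; have l0 : 0 < ln u by exact: ln_gt0.
have s0 := sqrtr_ge0 alpha; rewrite ler_pdivlMr //.
have [a0|a0] := ltP a 0.
  by have : 0 <= (- a) * ln u; [apply: mulr_ge0; lra | lra].
have [l2|l2] := leP 2 (ln u).
  have := ler_wpM2l a0 (log_gap_ge_half (ltW u1) l2); nra.
have := ler_wpM2l a0 (log_gap_ge_sqr (ltW u1) (ltW l2)) => h.
have sq : (a * ln u) ^+ 2 <= (2 * Num.sqrt alpha) ^+ 2.
  rewrite !exprMn sqr_sqrtr //.
  have : a * (a * ln u ^+ 2) <= 1 * (a * ln u ^+ 2).
    by rewrite ler_wpM2r // mulr_ge0 ?sqr_ge0.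
  nra.
have : a * ln u <= 2 * Num.sqrt alpha.
  by rewrite -ler_sqr ?nnegrE ?mulr_ge0 // ltW.
lra.
Qed.

Lemma phi_quarticE (N : nat) (rmin u : R) : 0 <= u -> N%:R * rmin - 1 = u ^+ 4 ->
  phi N rmin = u ^+ 2 / (1 + u ^+ 2).
Proof.
by move=> u0 Nu; rewrite /phi Nu (exprM u 2 2) sqrtr_sqr ger0_norm ?sqr_ge0.
Qed.

(* The slack [u (1 + u^2) <= 1 + u^4] allows the likelihood threshold [u] to be
   the fourth root of [N rmin - 1]. *)
Lemma risk_bound_le (u M A alpha : R) : 1 < u -> u ^+ 4 + 1 <= M ->
  A <= M -> 0 <= alpha -> A * log_gap u <= M * alpha ->
  M * (u ^+ 2 / (1 + u ^+ 2) * (1 - (ln (u ^+ 4))^-1 *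
    (512 * alpha + Num.sqrt (256 * alpha)))) <= M - u - A.
Proof.
move=> u1 uM AM al0 Agap.
have u0 : 0 < u by lra.
have M0 : 0 < M by have := exprn_ge0 4 (ltW u0); lra.
have l0 : 0 < ln u by exact: ln_gt0.
have -> : Num.sqrt (256 * alpha) = 16 * Num.sqrt alpha.
  have -> : 256 * alpha = (16 * Num.sqrt alpha) ^+ 2.
    by rewrite exprMn sqr_sqrtr //; ring.
  by rewrite sqrtr_sqr ger0_norm // mulr_ge0 ?ler0n ?sqrtr_ge0.
rewrite lnXn // -[ln u *+ 4]mulr_natl.
have aA : A / M <= (2 * alpha + 2 * Num.sqrt alpha) / ln u.
  apply: log_gap_tail_le => //; first by rewrite ler_pdivrMr ?mul1r.
  by rewrite mulrAC ler_pdivrMr // [leRHS]mulrC.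
have uu : u / M <= 1 - u ^+ 2 / (1 + u ^+ 2).
  have v0 : 0 < 1 + u ^+ 2 by have := exprn_ge0 2 (ltW u0); lra.
  have -> : 1 - u ^+ 2 / (1 + u ^+ 2) = (1 + u ^+ 2)^-1.
    by field; rewrite gt_eqF.
  rewrite ler_pdivrMr // ler_pdivlMl //; apply: le_trans uM.
  have : 0 <= (u - 1) ^+ 2 * (u ^+ 2 + u + 1).
    by rewrite mulr_ge0 ?sqr_ge0 // !addr_ge0 ?exprn_ge0 // ltW.
  have -> : (u - 1) ^+ 2 * (u ^+ 2 + u + 1) = u ^+ 4 + 1 - (1 + u ^+ 2) * u by ring.
  lra.
have ph : 1 / 2 <= u ^+ 2 / (1 + u ^+ 2).
  have u2 : 1 <= u ^+ 2 by rewrite exprn_ege1 // ltW.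
  by rewrite ler_pdivlMr; lra.
have -> : M - u - A = M * (1 - u / M - A / M) by field; rewrite gt_eqF.
rewrite ler_pM2l //; move: (u ^+ 2 / _) ph uu => f ph uu.
set E := _ * (512 * alpha + _).
have s0 := sqrtr_ge0 alpha.
have E0 : 0 <= E.
  by apply: mulr_ge0; [rewrite invr_ge0 mulr_ge0 // ltW | lra].
(* [ln (u ^ 4)] costs a factor 4 and [phi >= 1 / 2] a factor 2; the constant 256 is chosen so that
   its root 16, divided by 8, is the required 2. *)
have EE : (2 * alpha + 2 * Num.sqrt alpha) / ln u <= E / 2.
  have -> : E / 2 = (64 * alpha + 2 * Num.sqrt alpha) / ln u.
    by rewrite /E; field; rewrite gt_eqF.
  by apply: ler_wpM2r; rewrite ?invr_ge0 ?(ltW l0) //; lra.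
have := ler_wpM2r E0 ph; lra.
Qed.

End Arithmetic.

Section Mixture.
Context {R : realType}.
Variables (lambda mu p : R) (N T : nat) (x : state N).

Definition edge_pmf (th : 'M[bool]_N) : R :=
  \prod_(i < N) \prod_(j < N) bernoulli_pmf p (th i j).

Lemma edge_pmf_ge0 th : 0 < p -> p <= 1 -> 0 <= edge_pmf th.
Proof.
move=> p0 p1; apply: prodr_ge0 => i _; apply: prodr_ge0 => j _.
by apply: bernoulli_pmf_ge0; rewrite ltW.
Qed.

Lemma sum_edge_pmf : \sum_th edge_pmf th = 1.
Proof.
rewrite (reindex_onto (fun f : {ffun 'I_N * 'I_N -> bool} => \matrix_(i, j) f (i, j))
  (fun th : 'M[bool]_N => [ffun ij => th ij.1 ij.2])) /=; last first.
  by move=> th _; apply/matrixP => i j; rewrite mxE ffunE.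
rewrite (eq_bigl xpredT) => [|f]; last first.
  by apply/eqP/ffunP => -[i j]; rewrite ffunE mxE.
transitivity (\sum_(f : {ffun 'I_N * 'I_N -> bool}) \prod_ij bernoulli_pmf p (f ij)).
  apply: eq_bigr => f _; rewrite /edge_pmf pair_bigA /=.
  by apply: eq_bigr => -[i j] _; rewrite mxE.
rewrite -(bigA_distr_bigA (fun _ c => bernoulli_pmf p c)) big1 // => i _.
by rewrite big_bool; exact: (bernoulli_pmfD p true).
Qed.

(** Theta has the same law under every [S], so bounds for each fixed [th] can be averaged with
    common weights. *)
Lemma Prob_mixture S (E : pred (outcome N T)) :
  Prob lambda mu p x S E =
  \sum_th edge_pmf th * \sum_(w | E (th, w)) path_law (transition lambda mu th S) x w.
Proof.
under [RHS]eq_bigr do rewrite big_mkcond big_distrr /=.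
rewrite pair_bigA /= /Prob big_mkcond /=; apply: eq_bigr => -[th w] _ /=.
case: (E _); last by rewrite mulr0.
by rewrite /law /path_law /edge_pmf mulrA.
Qed.

End Mixture.

(** * Choice of the hypotheses and reduction of the minimax risk *)

Lemma exists_set_card (N k : nat) : (k <= N)%N ->
  exists S : {set 'I_N}, #|S| = k.
Proof.
move=> kN; exists [set i in take k (enum 'I_N)]%SET.
rewrite cardsE (card_uniqP _) ?take_uniq ?enum_uniq // size_take size_enum_ord.
by case: ltngtP kN.
Qed.

Lemma card_core (N : nat) (S0 : {set 'I_N}) (c : bool) :
  #|core S0 c| = if c then #|S0| else (N - #|S0|)%N.
Proof.
case: c; first by apply: eq_card => k; rewrite inE eqb_id.
have -> : core S0 false = (~: S0)%SET by apply/setP => k; rewrite !inE eqbF_neg.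
by rewrite [in LHS]cardsCs finset.setCK card_ord.
Qed.

Lemma card_toggle (N : nat) (S0 : {set 'I_N}) (c : bool) (j : 'I_N) :
  j \in core S0 c -> #|toggle S0 j| = if c then #|S0|.-1 else #|S0|.+1.
Proof.
rewrite inE => /eqP jc; case: c jc => jS.
  have -> : toggle S0 j = (S0 :\ j)%SET.
    by apply/setP => k; rewrite !inE; case: eqVneq => [->|]; rewrite ?jS ?addbF.
  by rewrite [in RHS](cardsD1 j) jS.
have -> : toggle S0 j = (j |: S0)%SET.
  by apply/setP => k; rewrite !inE; case: eqVneq => [->|]; rewrite ?jS ?addbF.
by rewrite cardsU1 jS.
Qed.

(** The larger side is used: if [N <= 2 * s], one element is removed from a set of size [s + 1];
    otherwise one is added to a set of size [s - 1]. *)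
Lemma exists_large_core (N s : nat) : (0 < s)%N -> (s < N)%N ->
  exists (S0 : {set 'I_N}) (c : bool), (N + 2 <= 2 * #|core S0 c|)%N /\
    forall j, j \in core S0 c -> #|toggle S0 j| = s.
Proof.
move=> s0 sN; pose c := (N <= 2 * s)%N.
have [S0 S0k] : exists S0 : {set 'I_N}, #|S0| = if c then s.+1 else s.-1.
  by apply: exists_set_card; case: c; lia.
exists S0, c; split.
  by rewrite card_core S0k /c; case: (leqP N (2 * s)) => ?; lia.
by move=> j /card_toggle ->; rewrite S0k; case: (c); rewrite //= prednK.
Qed.

Lemma minimax_risk_ge {R : realType} (lambda mu p rp : R) (N T : nat) (x : state N)
    (b : R) :
  (forall W : outcome N T -> {set 'I_N} * {set 'I_N},
     b <= max_risk lambda mu p rp x W) ->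
  b <= minimax_risk lambda mu p rp x T.
Proof.
move=> bW; apply: lb_le_inf; last by move=> _ [W _ <-].
(* The infimum needs a nonempty set of risks; a constant partition is measurable since its preimages
   are empty or everything. *)
exists (max_risk lambda mu p rp x (fun _ : outcome N T => (finset.setT, finset.set0))).
exists (fun=> (finset.setT, finset.set0)) => //; split.
  by move=> w; rewrite /is_bipartition /= finset.setU0 eqxx -finset.setI_eq0 finset.setI0 eqxx.
move=> A; have [At|nAt] := pselect (A (finset.setT, finset.set0)).
  exists setT => //; rewrite setTI; apply/seteqP; split => w //.
exists set0 => //; rewrite setTI; apply/seteqP; split => w //.
Qed.

Lemma max_risk_ge {R : realType} (lambda mu p rp : R) (N T : nat) (x : state N)
    (J : {set 'I_N}) (lab : 'I_N -> {set 'I_N}) (b : R)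
    (W : outcome N T -> {set 'I_N} * {set 'I_N}) :
  (0 < #|J|)%N -> (forall j, j \in J -> admissible rp (lab j)) ->
  #|J|%:R * b <= \sum_(j in J)
    Prob lambda mu p x (lab j) (fun w => W w != (lab j, ~: lab j)%SET) ->
  b <= max_risk lambda mu p rp x W.
Proof.
move=> J0 adm bJ; rewrite -(ler_pM2l (_ : 0 < #|J|%:R)) ?ltr0n //.
apply: (le_trans bJ); rewrite [leRHS]mulr_natl -sumr_const.
apply: ler_sum => j jJ; rewrite /max_risk.
exact: (le_bigmax_cond 0 (fun S => Prob lambda mu p x S
  (fun w => W w != (S, ~: S)%SET)) (adm j jJ)).
Qed.

(* The last hypothesis on N excludes the values for which the logarithm is
   negative, where the bound exceeds 1 for large T and cannot hold, or zero,
   where the bound is undefined. *)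
Theorem propositionF5 (R : realType) (lambda mu : R)
    (hlambda0 : 0 < lambda) (hlambda1 : lambda < 1)
    (hmu0 : 0 < mu) (hmulambda : mu <= lambda) :
  exists K : R, 0 < K /\
    forall (p rp rm : R)
      (hp0 : 0 < p) (hp1 : p <= 1)
      (hrp0 : 0 < rp) (hrp1 : rp < 1)
      (hrm0 : 0 < rm) (hrm1 : rm < 1)
      (hr : rp + rm = 1)
      (N : nat) (x : state N) (T : nat)
      (hN : Num.ceil (Num.min rp rm)^-1 <= N%:Z)
      (hNlog : ~~ (1 < N%:R * Num.min rp rm <= 2))
      (hT : (1 <= T)%N),
      let rmin := Num.min rp rm in
      phi N rmin *
        (1 - (ln (N%:R * rmin - 1))^-1 *
             (2 * K * T%:R / N%:R + Num.sqrt (K * T%:R / N%:R)))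
      <= minimax_risk lambda mu p rp x T.
Proof.
(* 256 comes from [risk_bound_le]; 208 is twice the 104 of [total_divergence_le], the core having at
   least [N / 2] elements. *)
exists (256 * (208 / mu ^+ 2)); split.
  by rewrite pmulr_rgt0 ?divr_gt0 ?ltr0n ?exprn_gt0.
move=> p rp rm hp0 hp1 hrp0 hrp1 hrm0 hrm1 hr N x T hN hNlog hT /=.
set K := 256 * _; set rmin := Num.min rp rm in hN hNlog *.
apply: minimax_risk_ge => W.
have [Nr1|Nr1] := leP (N%:R * rmin) 1.
  (* The square root of a nonpositive number is 0, so [phi] vanishes and nonnegativity of the risk
     suffices. *)
  rewrite /phi ler0_sqrtr ?mul0r; last lra.
  exact: bigmax_ge_id.
have Nr2 : 2 < N%:R * rmin by rewrite ltNge; move: hNlog; rewrite Nr1.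
have N0 : 0 < N%:R :> R.
  rewrite ltr0n lt0n; apply: contraTneq Nr1 => ->; rewrite mul0r -leNgt; lra.
have Nrp : N%:R * rmin <= N%:R * rp by rewrite ler_pM2l // ge_min lexx.
have Nrm : N%:R * rmin <= N%:R * rm by rewrite ler_pM2l // ge_min lexx orbT.
have NE : N%:R * rp + N%:R * rm = N%:R by rewrite -mulrDr hr mulr1.
pose s := `|Num.ceil (N%:R * rp)|%N.
have sE : s%:Z = Num.ceil (N%:R * rp).
  by rewrite gez0_abs // ceil_ge0; lra.
have /andP[slo shi] := ceil_itv (N%:R * rp).
rewrite -sE intrB /= -!pmulrn in slo shi.
have s2 : (2 < s)%N by rewrite -(ltr_nat R); lra.
have sN : (s.+1 < N)%N by rewrite -(ltr_nat R) -addn1 natrD; lra.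
have [S0 [c [Jc tog]]] := exists_large_core (ltnW (ltnW s2)) (ltnW sN).
have M_ge : N%:R + 2 <= 2 * #|core S0 c|%:R :> R.
  by rewrite -natrD -natrM ler_nat.
have core_gt1 : (1 < #|core S0 c|)%N by rewrite -(ltr_nat R); lra.
have [u [u0 u4]] : exists u : R, 0 <= u /\ N%:R * rmin - 1 = u ^+ 4.
  exists (Num.sqrt (Num.sqrt (N%:R * rmin - 1))); split; first exact: sqrtr_ge0.
  by rewrite (exprM _ 2 2) !sqr_sqrtr // ?sqrtr_ge0 //; lra.
have u1 : 1 < u.
  rewrite -(ltr_pXn2r (n := 4)) ?nnegrE // expr1n -u4; lra.
apply: (@max_risk_ge _ _ _ _ _ _ _ _ (core S0 c) (toggle S0)).
- exact: ltnW core_gt1.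
- by move=> j jJ; rewrite /admissible (tog _ jJ) -sE.
pose alpha := 208 / mu ^+ 2 * T%:R / N%:R.
rewrite (phi_quarticE u0 u4) u4.
have -> : 2 * K * T%:R / N%:R = 512 * alpha by rewrite /K /alpha; ring.
have -> : K * T%:R / N%:R = 256 * alpha by rewrite /K /alpha; ring.
set b := (X in X <= _).
have -> : \sum_(j in core S0 c) Prob lambda mu p x (toggle S0 j)
      (fun w => W w != (toggle S0 j, ~: toggle S0 j)%SET) =
    \sum_th edge_pmf p th * \sum_(j in core S0 c)
      \sum_(w | W (th, w) != (toggle S0 j, ~: toggle S0 j)%SET)
        path_law (transition lambda mu th (toggle S0 j)) x w.
  under eq_bigr do rewrite Prob_mixture.
  by rewrite exchange_big; apply: eq_bigr => th _; rewrite -big_distrr.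
rewrite -[b]mul1r -(sum_edge_pmf p N) big_distrl; apply: ler_sum => th _.
apply: ler_wpM2l; first exact: edge_pmf_ge0.
have Ngt0 : (0 < N)%N by rewrite -(ltr0n R).
have labI : injective (fun j => (toggle S0 j, ~: toggle S0 j)%SET).
  by move=> j k [/toggle_inj].
have [A [AM Agap Ab]] := star_family_error th hmu0 hmulambda hlambda1 Ngt0 core_gt1
  x (fun w => W (th, w)) labI hT (ltW u1).
(* [u ^ 4 + 1] is [N * rmin], at most [N / 2] because [rp + rm = 1]. *)
have uM : u ^+ 4 + 1 <= #|core S0 c|%:R by rewrite -u4; lra.
have alpha0 : 0 <= alpha.
  by rewrite /alpha !mulr_ge0 ?invr_ge0 ?ler0n ?sqr_ge0.
have Aalpha : A * log_gap u <= #|core S0 c|%:R * alpha.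
  apply: (le_trans Agap).
  have -> : #|core S0 c|%:R * alpha =
      (104 * T%:R / mu ^+ 2) * (2 * #|core S0 c|%:R / N%:R).
    by rewrite /alpha; field; rewrite !gt_eqF.
  rewrite -[leLHS]mulr1; apply: ler_wpM2l.
    by apply: mulr_ge0; rewrite ?invr_ge0 ?sqr_ge0 // mulr_ge0 ?ler0n.
  by rewrite ler_pdivlMr //; lra.
exact: le_trans (risk_bound_le u1 uM AM alpha0 Aalpha) Ab.
Qed.
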